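(* Let $S_1,S_2:[0,1]^2\to[0,1]$ be continuous cancellative t-subnorms with additive generators $s_1:[0,1]\to[s_1(1),\infty]$ and $s_2:[0,1]\to[s_2(1),\infty]$, respectively (normalized, i.e. $s_i(1)=1$, whenever $S_i$ is proper). If the function $s_1\circ s_2^{-1}:[s_2(1),\infty]\to[s_1(1),\infty]$ is convex, then the following are equivalent: (i) $S_1\le S_2$ (pointwise on $[0,1]^2$); (ii) the function $s_1\circ s_2^{-1}$ is quasi-homogeneous, i.e. for all $x\in[s_2(1),\infty]$ and all real $t\ge1$, $$s_1\circ s_2^{-1}(tx)\le t\cdot s_1\circ s_2^{-1}(x).$$
   Context: A t-subnorm is a binary operation $S:[0,1]^2\to[0,1]$ that is commutative, associative, non-decreasing in both variables and satisfies $S(x,y)\le\min(x,y)$. It is cancellative if $S(x,y)=S(x,z)$ with $x>0$ implies $y=z$. A t-norm is a t-subnorm having $1$ as neutral element; a t-subnorm that is not a t-norm is called proper. By a known representation theorem, a t-subnorm $S$ is continuous and cancellative if and only if there is a continuous, strictly decreasing function $s:[0,1]\to[0,\infty]$ with $s(0)=\infty$ such that $S(x,y)=s^{-1}(s(x)+s(y))$ for all $x,y\in[0,1]$, where $s$ is viewed as a bijection $[0,1]\to[s(1),\infty]$ with inverse $s^{-1}$. Such an $s$ is called an additive generator of $S$; it is unique up to a positive multiplicative constant; $S$ is a (strict) t-norm iff $s(1)=0$ and proper iff $s(1)>0$. When $S$ is proper, its normalized additive generator is the one with $s(1)=1$. Convexity of $h:[a,\infty]\to[0,\infty]$ (with $h(\infty)=\infty$,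 $h$ finite elsewhere) means $h(\lambda x+(1-\lambda)y)\le\lambda h(x)+(1-\lambda)h(y)$ for all $x,y\in[a,\infty)$ and $\lambda\in[0,1]$. Convention: $t\cdot\infty=\infty$ for $t\ge1$. *)

(* Defs.v *)
From mathcomp Require Export all_boot all_order all_algebra.
From mathcomp Require Export all_classical all_reals all_analysis.
Export numFieldNormedType.Exports.

Set Implicit Arguments.
Unset Strict Implicit.
Unset Printing Implicit Defensive.

Import Order.TTheory GRing.Theory Num.Theory.

Local Open Scope classical_set_scope.
Local Open Scope ring_scope.

(* A binary operation on [0, 1] is represented by a function R -> R -> R whose
   values outside the unit square are irrelevant; likewise, a function on
   [0, 1] with values in [0, +oo] is represented by a function R -> \bar R. *)

Definition tsubnorm (R : realType) (S : R -> R -> R) : Prop :=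
  [/\ {in `[0, 1] &, forall x y, S x y \in `[0, 1]},
      {in `[0, 1] &, forall x y, S x y = S y x},
      {in `[0, 1] & &, forall x y z, S (S x y) z = S x (S y z)},
      {in `[0, 1] & &, forall x y z, y <= z -> S x y <= S x z /\ S y x <= S z x}
    & {in `[0, 1] &, forall x y, S x y <= Num.min x y}].

Definition tnorm (R : realType) (S : R -> R -> R) : Prop :=
  tsubnorm S /\ {in `[0, 1], forall x, S x 1 = x /\ S 1 x = x}.

Definition proper_tsubnorm (R : realType) (S : R -> R -> R) : Prop :=
  tsubnorm S /\ ~ tnorm S.

Definition cancellative (R : realType) (S : R -> R -> R) : Prop :=
  {in `[0, 1] & &, forall x y z, 0 < x -> S x y = S x z -> y = z}.

Definition continuous_op (R : realType) (S : R -> R -> R) : Prop :=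
  {within (`[0, 1]%classic : set R) `*` (`[0, 1]%classic : set R),
    continuous (fun p : R * R => S p.1 p.2)}.

(* The inverse of [s], viewed as a bijection from [0, 1] onto [s 1, +oo]; its
   values outside the image of [0, 1] are irrelevant. *)
Definition gen_inv (R : realType) (s : R -> \bar R) : \bar R -> R :=
  pinv (`[0, 1]%classic : set R) s.

Definition additive_generator (R : realType) (S : R -> R -> R)
    (s : R -> \bar R) : Prop :=
  [/\ {in `[0, 1], forall x, (0 <= s x)%E},
      {within (`[0, 1]%classic : set R), continuous s},
      {in `[0, 1] &, forall x y, x < y -> (s y < s x)%E},
      s 0 = +oo%E
    & {in `[0, 1] &, forall x y, S x y = gen_inv s (s x + s y)%E}].

(* Convexity of h : [a, +oo] -> [0, +oo] is tested on the finite points of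
   [a, +oo] only. *)
Definition convex_from (R : realType) (a : \bar R) (h : \bar R -> \bar R)
    : Prop :=
  forall x y l : R, (a <= x%:E)%E -> (a <= y%:E)%E -> 0 <= l <= 1 ->
    (h (l * x + (1 - l) * y)%:E <= l%:E * h x%:E + (1 - l)%:E * h y%:E)%E.

Definition quasi_homogeneous_from (R : realType) (a : \bar R)
    (h : \bar R -> \bar R) : Prop :=
  forall (x : \bar R) (t : R), (a <= x)%E -> 1 <= t ->
    (h (t%:E * x) <= t%:E * h x)%E.

(* Main.v *)
(** Put [h = s1 \o gen_inv s2]. Since [s1] is decreasing and
    [s (S x y) = s x + s y], the inequality [S1 <= S2] says exactly that [h] is
    subadditive on [[s2 1, +oo]]. Quasi-homogeneity means that [h x / x] is
    nonincreasing, which gives subadditivity. Conversely, subadditivity gives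
    [h (n x) <= n h x] for integers [n >= 1], and convexity interpolates this
    bound between consecutive integers. *)
Require Import Defs.
From mathcomp Require Import ring lra.
Import Order.TTheory GRing.Theory Num.Theory.
Local Open Scope ring_scope.

Set Implicit Arguments.
Unset Strict Implicit.
Unset Printing Implicit Defensive.

(** An intermediate value argument in the extended reals: the image of the segment is connected, and
    an omitted value [v] would split it between [s 1] and [s 0 = +oo]. *)
Lemma additive_generator_surj (R : realType) (S : R -> R -> R) (s : R -> \bar R)
    (v : \bar R) :
  additive_generator S s -> (s 1%R <= v)%E -> exists2 x, x \in `[0, 1] & s x = v.
Proof.
move=> [_ cs _ s0 _] s1v; apply: contrapT => nex.
have nv x : x \in `[0, 1] -> s x != v.
  by move=> x01; apply/eqP => sx; apply: nex; exists x.
pose I := (`[0, 1]%classic : set R); pose A := (s @` I)%classic.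
have cA : connected A.
  by apply: connected_continuous_connected cs; exact: segment_connected.
have I0 : (0 : R) \in `[0, 1] by rewrite in_itv/= lexx ler01.
have I1 : (1 : R) \in `[0, 1] by rewrite in_itv/= ler01 lexx.
have : (A `&` [set y | y < v]%E)%classic = A.
  apply: cA.
  - exists (s 1); split; first by exists 1.
    by rewrite /= lt_neqAle nv.
  - by exists [set y | (y < v)%E]%classic => //; exact: open_ereal_lt_ereal.
  (* As [v] is not attained, [<] and [<=] cut out the same part of [A], which is thus also closed in
     [A]. *)
  - exists [set y | (y <= v)%E]%classic; first exact: closed_ereal_ge_ereal.
    apply/seteqP; split => [y [Ay /= /ltW]//|_ [[x Ix <-] /= sxv]].
    by split; [exists x|rewrite /= lt_neqAle nv].
move/seteqP => [_ /(_ (s 0))[|_ /=]]; first by exists 0.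
by rewrite s0 ltNge leey.
Qed.

Section additive_generator.
Variables (R : realType) (S : R -> R -> R) (s : R -> \bar R).
Hypothesis gen : additive_generator S s.

Lemma additive_generator_ge (x : R) : x \in `[0, 1] -> (s 1%R <= s x)%E.
Proof.
case: gen => _ _ sdec _ _ x01; have := x01; rewrite in_itv/= => /andP[_].
rewrite le_eqVlt => /predU1P[->//|x1]; apply/ltW/sdec => //.
by rewrite in_itv/= ler01 lexx.
Qed.

Lemma additive_generator_le (x y : R) : x \in `[0, 1] -> y \in `[0, 1] ->
  (s x <= s y)%E = (y <= x).
Proof.
case: gen => _ _ sdec _ _ x01 y01; case: (ltgtP y x) => [yx|xy|->].
- exact/ltW/sdec.
- by apply/negbTE; rewrite -ltNge; exact: sdec.
- exact: lexx.
Qed.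

Lemma gen_invK (x : R) : x \in `[0, 1] -> gen_inv s (s x) = x.
Proof.
move=> x01; apply: pinvKV; last by rewrite inE.
move=> y z; rewrite !inE => y01 z01 yz; apply/le_anti.
by rewrite -!additive_generator_le// yz lexx.
Qed.

(** The sum is at least [s 1], so it lies in the image of [s], where [gen_inv s] is a genuine
    inverse. *)
Lemma additive_generatorD (x y : R) : x \in `[0, 1] -> y \in `[0, 1] ->
  s (S x y) = (s x + s y)%E.
Proof.
case: (gen) => s_ge0 _ _ _ SE x01 y01; rewrite SE//.
have [z z01 zE] : exists2 z, z \in `[0, 1] & s z = (s x + s y)%E.
  apply: (additive_generator_surj gen).
  by rewrite (le_trans (additive_generator_ge x01))// leeDl// s_ge0.
by rewrite -zE gen_invK.
Qed.

End additive_generator.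

Definition subadditive_from (R : realType) (a : \bar R) (h : \bar R -> \bar R) :=
  forall u v : \bar R, (a <= u)%E -> (a <= v)%E -> (h (u + v) <= h u + h v)%E.

Section subadditive_convex.
Variables (R : realType) (a : \bar R) (h : \bar R -> \bar R).
Hypothesis a_ge0 : (0 <= a)%E.
Hypothesis h_ge0 : forall u, (a <= u)%E -> (0 <= h u)%E.

(** Both [u] and [v] are scaled up to [u + v]; the resulting weights [u / (u + v)] and [v / (u + v)]
    add up to 1. *)
Lemma quasi_homogeneous_subadditive :
  quasi_homogeneous_from a h -> subadditive_from a h.
Proof.
have aNy : (a <= -oo)%E = false.
  by apply/negbTE; rewrite -ltNge (lt_le_trans _ a_ge0).
move=> qh [u| |] [v| |]; rewrite ?aNy// => au av.
- have u_ge0 : 0 <= u by rewrite -lee_fin (le_trans a_ge0).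
  have v_ge0 : 0 <= v by rewrite -lee_fin (le_trans a_ge0).
  (* A zero argument cannot be scaled up, but then nonnegativity of [h] at 0 is enough. *)
  have [u0|u0] := eqVneq u 0; first by rewrite u0 add0e leeDr// -u0 h_ge0.
  have [v0|v0] := eqVneq v 0; first by rewrite v0 adde0 leeDl// -v0 h_ge0.
  have u_gt0 : 0 < u by rewrite lt_neqAle eq_sym u0.
  have v_gt0 : 0 < v by rewrite lt_neqAle eq_sym v0.
  have w_gt0 : 0 < u + v by exact: addr_gt0.
  (* Quasi-homogeneity at [z] with factor [(u + v) / z], which is at least 1. *)
  have share z : 0 < z -> z <= u + v -> (a <= z%:E)%E ->
      ((z / (u + v))%:E * h (u + v)%:E <= h z%:E)%E.
    move=> z_gt0 zw az.
    have := qh z%:E ((u + v) / z) az.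
    rewrite ler_pdivlMr// mul1r => /(_ zw).
    rewrite -EFinM divfK ?gt_eqF// => hw.
    by rewrite -[(z / _)%R]invrK invf_div lee_pdivrMl ?divr_gt0.
  rewrite -EFinD; have -> : h (u + v)%:E =
      ((u / (u + v))%:E * h (u + v)%:E + (v / (u + v))%:E * h (u + v)%:E)%E.
    rewrite -ge0_muleDl ?lee_fin ?divr_ge0 ?(ltW w_gt0)//.
    by rewrite -EFinD -mulrDl divff ?gt_eqF// mul1e.
  by apply: leeD; apply: share => //; rewrite ?lerDl ?lerDr.
- by rewrite leeDr// h_ge0.
- by rewrite leeDl// h_ge0.
- by rewrite leeDl// h_ge0.
Qed.

Lemma le_natM_from (x : R) (n : nat) : (a <= x%:E)%E -> (a <= (n.+1%:R * x)%:E)%E.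
Proof.
move=> ax; apply: (le_trans ax); rewrite lee_fin ler_peMl ?ler1n//.
by rewrite -lee_fin (le_trans a_ge0).
Qed.

Lemma subadditive_natM (x : R) (n : nat) : subadditive_from a h ->
  (a <= x%:E)%E -> (h (n.+1%:R * x)%:E <= n.+1%:R%:E * h x%:E)%E.
Proof.
move=> hD ax; elim: n => [|n IHn]; first by rewrite mul1r mul1e.
rewrite -addn1 natrD mulrDl mul1r EFinD.
apply: le_trans (hD _ _ (le_natM_from n ax) ax) _.
by rewrite EFinD ge0_muleDl ?lee_fin// mul1e leeD2r.
Qed.

(** The bound [t * h x] is affine in [t], so convexity carries it from the integers on either side
    of [t] to [t] itself. *)
Lemma subadditive_convex_quasi_homogeneous : h +oo%E = +oo%E ->
  convex_from a h -> subadditive_from a h -> quasi_homogeneous_from a h.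
Proof.
move=> hoo convh hD [x| |] t ax t1.
(* Since [1 <= t], the integer part is some [n.+1], and [t] lies between [n.+1] and [n.+2]. *)
- case: (Num.truncn t) (truncn_itv (le_trans ler01 t1)) => [|n] /andP[nt tn].
    by rewrite ltNge t1 in tn.
  pose l : R := n.+2%:R - t.
  have n2 : n.+2%:R = n.+1%:R + 1 :> R by rewrite -natr1.
  have l01 : 0 <= l <= 1 by rewrite /l; apply/andP; split; lra.
  have tE : t = l * n.+1%:R + (1 - l) * n.+2%:R by rewrite /l n2; ring.
  clearbody l.
  rewrite -EFinM.
  have -> : t * x = l * (n.+1%:R * x) + (1 - l) * (n.+2%:R * x).
    by rewrite {1}tE; ring.
  apply: le_trans (convh _ _ _ (le_natM_from n ax) (le_natM_from n.+1 ax) l01) _.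
  move/andP: l01 => [l_ge0 l_le1].
  (* The scalars are nonnegative, so distributivity holds even where [h x] is infinite. *)
  have -> : (t%:E * h x%:E = l%:E * (n.+1%:R%:E * h x%:E) +
      (1 - l)%:E * (n.+2%:R%:E * h x%:E))%E.
    rewrite !muleA -!EFinM -ge0_muleDl ?lee_fin ?mulr_ge0 ?subr_ge0//.
    by rewrite -EFinD -tE.
  by apply: leeD; apply: lee_wpmul2l; rewrite ?lee_fin ?subr_ge0//;
    exact: subadditive_natM.
- by rewrite hoo gt0_muley ?hoo// lte_fin (lt_le_trans ltr01).
- by have := le_trans a_ge0 ax.
Qed.

End subadditive_convex.

(** Applying the decreasing [s1] turns [S1 x y] into [s1 x + s1 y] and [S2 x y] into
    [h (s2 x + s2 y)]; surjectivity of [s2] lets [s2 x] and [s2 y] be arbitrary points of the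
    domain. *)
Lemma le_tsubnorm_subadditive (R : realType) (S1 S2 : R -> R -> R)
    (s1 s2 : R -> \bar R) :
  tsubnorm S1 -> tsubnorm S2 ->
  additive_generator S1 s1 -> additive_generator S2 s2 ->
  {in `[0, 1] &, forall x y, S1 x y <= S2 x y} <->
  subadditive_from (s2 1) (s1 \o gen_inv s2).
Proof.
move=> [S1in _ _ _ _] [S2in _ _ _ _] gen1 gen2.
have leE x y : x \in `[0, 1] -> y \in `[0, 1] -> (S1 x y <= S2 x y) =
    ((s1 \o gen_inv s2) (s2 x + s2 y) <=
     (s1 \o gen_inv s2) (s2 x) + (s1 \o gen_inv s2) (s2 y))%E.
  move=> x01 y01; rewrite -(additive_generatorD gen2)//= !(gen_invK gen2) ?S2in//.
  by rewrite -(additive_generatorD gen1)// (additive_generator_le gen1) ?S1in ?S2in.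
split=> [S12 u v|hD x y x01 y01].
- move=> /(additive_generator_surj gen2)[x x01 <-].
  move=> /(additive_generator_surj gen2)[y y01 <-].
  by rewrite -leE//; exact: S12.
- by rewrite leE//; apply: hD; exact: (additive_generator_ge gen2).
Qed.

Theorem proposition3p4 (R : realType) (S1 S2 : R -> R -> R)
    (s1 s2 : R -> \bar R)
    (tS1 : tsubnorm S1) (tS2 : tsubnorm S2)
    (contS1 : continuous_op S1) (contS2 : continuous_op S2)
    (cancS1 : cancellative S1) (cancS2 : cancellative S2)
    (gen1 : additive_generator S1 s1) (gen2 : additive_generator S2 s2)
    (norm1 : proper_tsubnorm S1 -> s1 1 = 1%E)
    (norm2 : proper_tsubnorm S2 -> s2 1 = 1%E)
    (convh : convex_from (s2 1) (s1 \o gen_inv s2)) :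
  {in `[0, 1] &, forall x y, S1 x y <= S2 x y} <->
  quasi_homogeneous_from (s2 1) (s1 \o gen_inv s2).
Proof.
case: (gen1) (gen2) => [s1_ge0 _ _ s10 _] [s2_ge0 _ _ s20 _].
have a_ge0 : (0 <= s2 1%R)%E by apply: s2_ge0; rewrite in_itv/= ler01 lexx.
have h_ge0 u : (s2 1%R <= u)%E -> (0 <= (s1 \o gen_inv s2) u)%E.
  move=> /(additive_generator_surj gen2)[x x01 <-].
  by rewrite /= (gen_invK gen2)// s1_ge0.
(* Both generators send 0 to [+oo]. *)
have hoo : (s1 \o gen_inv s2) +oo%E = +oo%E.
  by rewrite /= -s20 (gen_invK gen2) ?s10 ?s20// in_itv/= lexx ler01.
split=> [/(le_tsubnorm_subadditive tS1 tS2 gen1 gen2)|qh].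
- exact: subadditive_convex_quasi_homogeneous.
- apply/(le_tsubnorm_subadditive tS1 tS2 gen1 gen2).
  exact: quasi_homogeneous_subadditive.
Qed.
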